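(* Let $(\mathcal C,\otimes,I,\gamma)$ be a symmetric monoidal category and $\mathcal T$ a centralisable strong monad on it, and let $\mathcal Z$ be the commutative submonad of $\mathcal T$ with submonad monomorphism $\iota:\mathcal Z\Rightarrow\mathcal T$ obtained from the terminal central cones $(\mathcal ZX,\iota_X)$ of $\mathcal T$. Then the canonical embedding functor $\mathcal I:\mathcal C_{\mathcal Z}\to\mathcal C_{\mathcal T}$ corestricts to an isomorphism of categories $\mathcal C_{\mathcal Z}\cong Z(\mathcal C_{\mathcal T})$.
   Context: $\mathcal T=(\mathcal T,\eta,\mu,\tau)$ with left strength $\tau$ and right strength $\tau'_{X,Y}=\mathcal T(\gamma_{Y,X})\circ\tau_{Y,X}\circ\gamma_{\mathcal TX,Y}$. A central cone of $\mathcal T$ at $X$ is $(W,\iota)$, $\iota:W\to\mathcal TX$, with $\mu\circ\mathcal T\tau'_{X,Y}\circ\tau_{\mathcal TX,Y}\circ(\iota\otimes\mathcal TY)=\mu\circ\mathcal T\tau_{X,Y}\circ\tau'_{X,\mathcal TY}\circ(\iota\otimes\mathcal TY)$ for all $Y$; a terminal central cone is terminal among these (morphisms $\varphi$ with $\iota\circ\varphi=\iota'$); $\mathcal T$ is centralisable if every object has a terminal central cone $(\mathcal ZX,\iota_X)$. In that case $X\mapsto\mathcal ZX$ extends uniquely to a commutative strong monad $\mathcal Z$ such that $\iota$ is a monomorphism of strong monads (the centre of $\mathcal T$). Kleisli categories: $\mathcal C_{\mathcal T}$ has morphisms $X\to\mathcal TY$, composition $g\odot f=\mu\circ\mathcal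 Tg\circ f$. The canonical embedding $\mathcal I$ is the identity on objects and sends $f:X\to\mathcal ZY$ to $\iota_Y\circ f$. For $f:Y\to\mathcal TZ$, $f\otimes_l X=\tau'_{Z,X}\circ(f\otimes X)$ and $X\otimes_r f=\tau_{X,Z}\circ(X\otimes f)$; $f:X\to\mathcal TY$ is central if $(f\otimes_l Y')\odot(X\otimes_r f')=(Y\otimes_r f')\odot(f\otimes_l X')$ for every $f':X'\to\mathcal TY'$. $Z(\mathcal C_{\mathcal T})$ is the subcategory of $\mathcal C_{\mathcal T}$ with all objects and central morphisms. *)

(* Defs.v *)
From Stdlib Require Import ssreflect ProofIrrelevance FunctionalExtensionality.

Set Implicit Arguments.
Unset Strict Implicit.
Unset Printing Implicit Defensive.

Reserved Notation "g ∘ f" (at level 37, right associativity).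
Reserved Notation "X ⊗ Y" (at level 30, right associativity).
Reserved Notation "f ⊠ g" (at level 30, right associativity).
Reserved Notation "g ⊙ f" (at level 37, right associativity).

Record Category := {
  ob :> Type;
  Hom : ob -> ob -> Type;
  id_ : forall X, Hom X X;
  comp : forall X Y Z, Hom Y Z -> Hom X Y -> Hom X Z;
  comp_id_l : forall X Y (f : Hom X Y), comp (id_ Y) f = f;
  comp_id_r : forall X Y (f : Hom X Y), comp f (id_ X) = f;
  comp_assoc : forall X Y Z W (h : Hom Z W) (g : Hom Y Z) (f : Hom X Y),
    comp (comp h g) f = comp h (comp g f)
}.
Arguments Hom {c} X Y.
Arguments id_ {c} X.
Arguments comp {c X Y Z} g f.

Notation "g ∘ f" := (comp g f).

Record Functor (C D : Category) := {
  fobj :> C -> D;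
  fmap : forall X Y : C, Hom X Y -> Hom (fobj X) (fobj Y);
  fmap_id : forall X : C, fmap (id_ X) = id_ (fobj X);
  fmap_comp : forall (X Y Z : C) (g : Hom Y Z) (f : Hom X Y),
    fmap (g ∘ f) = fmap g ∘ fmap f
}.
Arguments fmap {C D} F {X Y} f : rename.

Definition functor_id (C : Category) : Functor C C :=
  {| fobj := fun X => X;
     fmap := fun X Y f => f;
     fmap_id := fun X => eq_refl;
     fmap_comp := fun X Y Z g f => eq_refl |}.

Definition functor_comp (C D E : Category)
    (G : Functor D E) (F : Functor C D) : Functor C E.
Proof.
refine {| fobj := fun X => G (F X);
          fmap := fun X Y f => fmap G (fmap F f) |}.
- abstract by move=> X; rewrite !fmap_id.
- abstract by move=> X Y Z g f; rewrite !fmap_comp.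
Defined.

Definition is_iso_of_categories (C D : Category) (F : Functor C D) : Prop :=
  exists G : Functor D C,
    functor_comp G F = functor_id C /\ functor_comp F G = functor_id D.

Record SymMonCat := {
  smc_cat :> Category;
  tens : smc_cat -> smc_cat -> smc_cat
    where "X ⊗ Y" := (tens X Y);
  unit_ : smc_cat;
  tmap : forall X X' Y Y' : smc_cat,
    Hom X X' -> Hom Y Y' -> Hom (X ⊗ Y) (X' ⊗ Y')
    where "f ⊠ g" := (tmap f g);
  tmap_id : forall X Y : smc_cat, id_ X ⊠ id_ Y = id_ (X ⊗ Y);
  tmap_comp : forall (X X' X'' Y Y' Y'' : smc_cat)
      (f' : Hom X' X'') (f : Hom X X') (g' : Hom Y' Y'') (g : Hom Y Y'),
    (f' ∘ f) ⊠ (g' ∘ g) = (f' ⊠ g') ∘ (f ⊠ g);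

  assoc : forall X Y Z : smc_cat, Hom ((X ⊗ Y) ⊗ Z) (X ⊗ (Y ⊗ Z));
  assoc_inv : forall X Y Z : smc_cat, Hom (X ⊗ (Y ⊗ Z)) ((X ⊗ Y) ⊗ Z);
  assocK : forall X Y Z : smc_cat, assoc_inv X Y Z ∘ assoc X Y Z = id_ _;
  assoc_invK : forall X Y Z : smc_cat, assoc X Y Z ∘ assoc_inv X Y Z = id_ _;
  assoc_nat : forall (X X' Y Y' Z Z' : smc_cat)
      (f : Hom X X') (g : Hom Y Y') (h : Hom Z Z'),
    assoc X' Y' Z' ∘ ((f ⊠ g) ⊠ h) = (f ⊠ (g ⊠ h)) ∘ assoc X Y Z;

  lunit : forall X : smc_cat, Hom (unit_ ⊗ X) X;
  lunit_inv : forall X : smc_cat, Hom X (unit_ ⊗ X);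
  lunitK : forall X : smc_cat, lunit_inv X ∘ lunit X = id_ _;
  lunit_invK : forall X : smc_cat, lunit X ∘ lunit_inv X = id_ _;
  lunit_nat : forall (X X' : smc_cat) (f : Hom X X'),
    lunit X' ∘ (id_ unit_ ⊠ f) = f ∘ lunit X;

  runit : forall X : smc_cat, Hom (X ⊗ unit_) X;
  runit_inv : forall X : smc_cat, Hom X (X ⊗ unit_);
  runitK : forall X : smc_cat, runit_inv X ∘ runit X = id_ _;
  runit_invK : forall X : smc_cat, runit X ∘ runit_inv X = id_ _;
  runit_nat : forall (X X' : smc_cat) (f : Hom X X'),
    runit X' ∘ (f ⊠ id_ unit_) = f ∘ runit X;

  pentagon : forall X Y Z W : smc_cat,
    assoc X Y (Z ⊗ W) ∘ assoc (X ⊗ Y) Z W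
    = (id_ X ⊠ assoc Y Z W) ∘ assoc X (Y ⊗ Z) W ∘ (assoc X Y Z ⊠ id_ W);
  triangle : forall X Y : smc_cat,
    (id_ X ⊠ lunit Y) ∘ assoc X unit_ Y = runit X ⊠ id_ Y;

  braid : forall X Y : smc_cat, Hom (X ⊗ Y) (Y ⊗ X);
  braid_nat : forall (X X' Y Y' : smc_cat) (f : Hom X X') (g : Hom Y Y'),
    braid X' Y' ∘ (f ⊠ g) = (g ⊠ f) ∘ braid X Y;
  braid_sym : forall X Y : smc_cat, braid Y X ∘ braid X Y = id_ _;
  hexagon : forall X Y Z : smc_cat,
    assoc Y Z X ∘ braid X (Y ⊗ Z) ∘ assoc X Y Z
    = (id_ Y ⊠ braid X Z) ∘ assoc Y X Z ∘ (braid X Y ⊠ id_ Z)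
}.
Arguments tens {s} X Y.
Arguments unit_ {s}.
Arguments tmap {s X X' Y Y'} f g.
Arguments assoc {s} X Y Z.
Arguments assoc_inv {s} X Y Z.
Arguments lunit {s} X.
Arguments lunit_inv {s} X.
Arguments runit {s} X.
Arguments runit_inv {s} X.
Arguments braid {s} X Y.

Notation "X ⊗ Y" := (tens X Y).
Notation "f ⊠ g" := (tmap f g).

Record Monad (C : Category) := {
  mon_functor :> Functor C C;
  eta : forall X : C, Hom X (mon_functor X);
  mu : forall X : C, Hom (mon_functor (mon_functor X)) (mon_functor X);
  eta_nat : forall (X Y : C) (f : Hom X Y),
    eta Y ∘ f = fmap mon_functor f ∘ eta X;
  mu_nat : forall (X Y : C) (f : Hom X Y),
    mu Y ∘ fmap mon_functor (fmap mon_functor f) = fmap mon_functor f ∘ mu X;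
  mu_eta_l : forall X : C, mu X ∘ eta (mon_functor X) = id_ _;
  mu_eta_r : forall X : C, mu X ∘ fmap mon_functor (eta X) = id_ _;
  mu_assoc : forall X : C,
    mu X ∘ mu (mon_functor X) = mu X ∘ fmap mon_functor (mu X)
}.
Arguments eta {C} T X : rename.
Arguments mu {C} T X : rename.

Record StrongMonad (C : SymMonCat) := {
  sm_monad :> Monad C;
  str : forall X Y : C, Hom (X ⊗ sm_monad Y) (sm_monad (X ⊗ Y));
  str_nat : forall (X X' Y Y' : C) (f : Hom X X') (g : Hom Y Y'),
    str X' Y' ∘ (f ⊠ fmap sm_monad g) = fmap sm_monad (f ⊠ g) ∘ str X Y;
  str_lunit : forall X : C,
    fmap sm_monad (lunit X) ∘ str unit_ X = lunit (sm_monad X);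
  str_assoc : forall X Y Z : C,
    fmap sm_monad (assoc X Y Z) ∘ str (X ⊗ Y) Z
    = str X (Y ⊗ Z) ∘ (id_ X ⊠ str Y Z) ∘ assoc X Y (sm_monad Z);
  str_eta : forall X Y : C,
    str X Y ∘ (id_ X ⊠ eta sm_monad Y) = eta sm_monad (X ⊗ Y);
  str_mu : forall X Y : C,
    str X Y ∘ (id_ X ⊠ mu sm_monad Y)
    = mu sm_monad (X ⊗ Y) ∘ fmap sm_monad (str X Y) ∘ str X (sm_monad Y)
}.
Arguments str {C} T X Y : rename.

Definition rstr (C : SymMonCat) (T : StrongMonad C) (X Y : C) :
    Hom (T X ⊗ Y) (T (X ⊗ Y)) :=
  fmap T (braid Y X) ∘ str T Y X ∘ braid (T X) Y.
Arguments rstr {C} T X Y.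

Definition is_commutative (C : SymMonCat) (T : StrongMonad C) : Prop :=
  forall X Y : C,
    mu T (X ⊗ Y) ∘ fmap T (rstr T X Y) ∘ str T (T X) Y
    = mu T (X ⊗ Y) ∘ fmap T (str T X Y) ∘ rstr T X (T Y).

Record is_strong_monad_morphism (C : SymMonCat) (S T : StrongMonad C)
    (i : forall X : C, Hom (S X) (T X)) : Prop := {
  smm_nat : forall (X Y : C) (f : Hom X Y), i Y ∘ fmap S f = fmap T f ∘ i X;
  smm_eta : forall X : C, i X ∘ eta S X = eta T X;
  smm_mu : forall X : C, i X ∘ mu S X = mu T X ∘ fmap T (i X) ∘ i (S X);
  smm_str : forall X Y : C,
    i (X ⊗ Y) ∘ str S X Y = str T X Y ∘ (id_ X ⊠ i Y)
}.

Definition is_mono (C : Category) (X Y : C) (m : Hom X Y) : Prop :=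
  forall (W : C) (f g : Hom W X), m ∘ f = m ∘ g -> f = g.

Definition kcomp (C : Category) (T : Monad C) (X Y Z : C)
    (g : Hom Y (T Z)) (f : Hom X (T Y)) : Hom X (T Z) :=
  mu T Z ∘ fmap T g ∘ f.

Notation "g ⊙ f" := (kcomp g f).

Section Kleisli.
Context (C : Category) (T : Monad C).

(* Equations between composites, in a form usable inside right-nested ones. *)
Lemma reassoc2 (D : Category) (W X Y Z : D) (a : Hom Y Z) (b : Hom X Y) c :
  a ∘ b = c -> forall z : Hom W X, a ∘ b ∘ z = c ∘ z.
Proof. by move=> <- z; rewrite comp_assoc. Qed.

Lemma reassoc3 (D : Category) (W X Y Z V : D)
    (a : Hom Z V) (b : Hom Y Z) (c : Hom X Y) d :
  a ∘ b ∘ c = d -> forall z : Hom W X, a ∘ b ∘ c ∘ z = d ∘ z.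
Proof. by move=> <- z; rewrite !comp_assoc. Qed.

Lemma kcomp_id_l (X Y : C) (f : Hom X (T Y)) : eta T Y ⊙ f = f.
Proof. by rewrite /kcomp (reassoc2 (mu_eta_r _ _)) comp_id_l. Qed.

Lemma kcomp_pure_r (X Y Z : C) (g : Hom Y (T Z)) (f : Hom X Y) :
  g ⊙ (eta T Y ∘ f) = g ∘ f.
Proof.
by rewrite /kcomp (reassoc2 (eq_sym (eta_nat T g))) comp_assoc
  (reassoc2 (mu_eta_l _ _)) comp_id_l.
Qed.

Lemma kcomp_id_r (X Y : C) (g : Hom X (T Y)) : g ⊙ eta T X = g.
Proof. by rewrite -{1}(comp_id_r (eta T X)) kcomp_pure_r comp_id_r. Qed.

Lemma kcomp_pure_l (X Y Z : C) (g : Hom Y Z) (f : Hom X (T Y)) :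
  (eta T Z ∘ g) ⊙ f = fmap T g ∘ f.
Proof.
by rewrite /kcomp fmap_comp comp_assoc (reassoc2 (mu_eta_r _ _)) comp_id_l.
Qed.

Lemma kcomp_assoc (X Y Z W : C)
    (h : Hom Z (T W)) (g : Hom Y (T Z)) (f : Hom X (T Y)) :
  (h ⊙ g) ⊙ f = h ⊙ (g ⊙ f).
Proof.
rewrite /kcomp !fmap_comp !comp_assoc (reassoc2 (eq_sym (mu_assoc _ _))) comp_assoc.
by rewrite (reassoc2 (mu_nat _ _)) comp_assoc.
Qed.

Definition kleisli : Category :=
  {| ob := ob C;
     Hom := fun X Y => Hom X (T Y);
     id_ := fun X => eta T X;
     comp := fun X Y Z g f => g ⊙ f;
     comp_id_l := kcomp_id_l;
     comp_id_r := kcomp_id_r;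
     comp_assoc := kcomp_assoc |}.

Lemma kcomp_post (X Y Z W : C) (h : Hom Z W) (g : Hom Y (T Z))
    (f : Hom X (T Y)) : fmap T h ∘ (g ⊙ f) = (fmap T h ∘ g) ⊙ f.
Proof. by rewrite -!kcomp_pure_l kcomp_assoc. Qed.

Lemma kcomp_mid (X Y Y' Z : C) (g : Hom Y' (T Z)) (h : Hom Y Y')
    (f : Hom X (T Y)) : (g ∘ h) ⊙ f = g ⊙ (fmap T h ∘ f).
Proof. by rewrite -kcomp_pure_l -kcomp_assoc kcomp_pure_r. Qed.

Lemma kcomp_pre (W X Y Z : C) (g : Hom Y (T Z)) (f : Hom X (T Y))
    (h : Hom W X) : (g ⊙ f) ∘ h = g ⊙ (f ∘ h).
Proof. by rewrite /kcomp !comp_assoc. Qed.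

End Kleisli.

Section Central.
Context (C : SymMonCat) (T : StrongMonad C).

Definition lten (Y Z : C) (f : Hom Y (T Z)) (X : C) :
    Hom (Y ⊗ X) (T (Z ⊗ X)) := rstr T Z X ∘ (f ⊠ id_ X).

Definition rten (X Y Z : C) (f : Hom Y (T Z)) :
    Hom (X ⊗ Y) (T (X ⊗ Z)) := str T X Z ∘ (id_ X ⊠ f).

Definition is_central (X Y : C) (f : Hom X (T Y)) : Prop :=
  forall (X' Y' : C) (f' : Hom X' (T Y')),
    lten f Y' ⊙ rten X f' = rten Y f' ⊙ lten f X'.

Definition is_central_cone (X W : C) (i : Hom W (T X)) : Prop :=
  forall Y : C,
    mu T (X ⊗ Y) ∘ fmap T (rstr T X Y) ∘ str T (T X) Y ∘ (i ⊠ id_ (T Y))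
    = mu T (X ⊗ Y) ∘ fmap T (str T X Y) ∘ rstr T X (T Y) ∘ (i ⊠ id_ (T Y)).

Record CentralCone (X : C) := {
  apex : C;
  leg : Hom apex (T X);
  leg_central : is_central_cone leg
}.

Record TerminalCentralCone (X : C) := {
  tcc :> CentralCone X;
  tcc_lift : forall c : CentralCone X, Hom (apex c) (apex tcc);
  tcc_lift_comm : forall c : CentralCone X, leg tcc ∘ tcc_lift c = leg c;
  tcc_lift_unique : forall (c : CentralCone X) (phi : Hom (apex c) (apex tcc)),
    leg tcc ∘ phi = leg c -> phi = tcc_lift c
}.

(* A choice of one terminal central cone [(Z X, iota_X)] for every object. *)
Definition Centralisable : Type := forall X : C, TerminalCentralCone X.

Lemma tmap_compl (X X' X'' Y Y' : C) (f' : Hom X' X'') (f : Hom X X')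
    (g : Hom Y Y') : (f' ∘ f) ⊠ g = (f' ⊠ id_ Y') ∘ (f ⊠ g).
Proof. by rewrite -tmap_comp comp_id_l. Qed.

Lemma tmap_compr (X X' Y Y' Y'' : C) (f : Hom X X') (g' : Hom Y' Y'')
    (g : Hom Y Y') : f ⊠ (g' ∘ g) = (id_ X' ⊠ g') ∘ (f ⊠ g).
Proof. by rewrite -tmap_comp comp_id_l. Qed.

Lemma tmap_lr (X X' Y Y' : C) (f : Hom X X') (g : Hom Y Y') :
  (f ⊠ id_ Y') ∘ (id_ X ⊠ g) = f ⊠ g.
Proof. by rewrite -tmap_comp comp_id_l comp_id_r. Qed.

Lemma tmap_rl (X X' Y Y' : C) (f : Hom X X') (g : Hom Y Y') :
  (id_ X' ⊠ g) ∘ (f ⊠ id_ Y) = f ⊠ g.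
Proof. by rewrite -tmap_comp comp_id_l comp_id_r. Qed.

Lemma str_nat_l (X X' Y : C) (f : Hom X X') :
  str T X' Y ∘ (f ⊠ id_ (T Y)) = fmap T (f ⊠ id_ Y) ∘ str T X Y.
Proof. by rewrite -str_nat fmap_id. Qed.

Lemma fmap_braidK (X Y : C) :
  fmap T (braid Y X) ∘ fmap T (braid X Y) = id_ (T (X ⊗ Y)).
Proof. by rewrite -fmap_comp braid_sym fmap_id. Qed.

Lemma lten_rten (Y Z : C) (f : Hom Y (T Z)) (X : C) :
  lten f X = fmap T (braid X Z) ∘ rten X f ∘ braid Y X.
Proof. by rewrite /lten /rstr /rten !comp_assoc braid_nat. Qed.

Lemma rten_kcomp (A X Y Z : C) (g : Hom Y (T Z)) (f : Hom X (T Y)) :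
  rten A (g ⊙ f) = rten A g ⊙ rten A f.
Proof.
rewrite /rten /kcomp !tmap_compr (reassoc2 (str_mu _ _ _)) !comp_assoc.
by rewrite fmap_comp (reassoc2 (str_nat _ _ _)) !comp_assoc.
Qed.

Lemma rten_pure (A X Y : C) (f : Hom X Y) :
  rten A (eta T Y ∘ f) = eta T _ ∘ (id_ A ⊠ f).
Proof. by rewrite /rten tmap_compr (reassoc2 (str_eta _ _ _)). Qed.

Lemma rten_fmap (A X Y Z : C) (f : Hom X (T Y)) (h : Hom Y Z) :
  rten A (fmap T h ∘ f) = fmap T (id_ A ⊠ h) ∘ rten A f.
Proof. by rewrite /rten tmap_compr (reassoc2 (str_nat _ _ _)) comp_assoc. Qed.

Lemma rten_comp (A X Y Z : C) (f : Hom Y (T Z)) (h : Hom X Y) :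
  rten A (f ∘ h) = rten A f ∘ (id_ A ⊠ h).
Proof. by rewrite /rten tmap_compr comp_assoc. Qed.

Lemma rten_nat (A B X Y : C) (h : Hom A B) (f : Hom X (T Y)) :
  fmap T (h ⊠ id_ Y) ∘ rten A f = rten B f ∘ (h ⊠ id_ X).
Proof.
by rewrite /rten (reassoc2 (eq_sym (str_nat_l _ _))) !comp_assoc tmap_lr tmap_rl.
Qed.

Lemma lten_kcomp (A X Y Z : C) (g : Hom Y (T Z)) (f : Hom X (T Y)) :
  lten (g ⊙ f) A = lten g A ⊙ lten f A.
Proof.
rewrite !lten_rten rten_kcomp kcomp_pre kcomp_post.
rewrite -[in RHS](comp_assoc (fmap T (braid A Z))) [in RHS]kcomp_mid.
by rewrite (reassoc2 (fmap_braidK _ _)) comp_id_l.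
Qed.

Lemma lten_pure (A X Y : C) (f : Hom X Y) :
  lten (eta T Y ∘ f) A = eta T _ ∘ (f ⊠ id_ A).
Proof.
rewrite lten_rten rten_pure comp_assoc -braid_nat.
by rewrite (reassoc2 (eq_sym (eta_nat _ _))) comp_assoc (reassoc2 (braid_sym _ _)) comp_id_l.
Qed.

Lemma lten_nat (A B X Y : C) (h : Hom A B) (f : Hom X (T Y)) :
  fmap T (id_ Y ⊠ h) ∘ lten f A = lten f B ∘ (id_ X ⊠ h).
Proof.
have N := rten_nat h f; rewrite !lten_rten.
move: (rten A f) (rten B f) N => p q N; rewrite !comp_assoc braid_nat.
rewrite (reassoc2 (eq_sym (fmap_comp _ _ _))) -braid_nat fmap_comp comp_assoc.
by rewrite (reassoc2 N) comp_assoc.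
Qed.

Lemma rten_assoc (A B X Y : C) (f : Hom X (T Y)) :
  fmap T (assoc A B Y) ∘ rten (A ⊗ B) f = rten A (rten B f) ∘ assoc A B X.
Proof.
rewrite /rten (reassoc2 (str_assoc _ _ _ _)) !comp_assoc.
by rewrite -tmap_id assoc_nat tmap_compr comp_assoc.
Qed.

Lemma lten_assoc (A X Y B : C) (f : Hom X (T Y)) :
  fmap T (assoc A Y B) ∘ lten (rten A f) B = rten A (lten f B) ∘ assoc A X B.
Proof.
have E : rten B (rten A f)
    = fmap T (assoc B A Y) ∘ rten (B ⊗ A) f ∘ assoc_inv B A X.
  by rewrite (reassoc2 (rten_assoc _ _ _)) comp_assoc assoc_invK comp_id_r.
have N := rten_nat (braid B A) f.
have S := rten_assoc A B f.
rewrite !lten_rten E rten_fmap rten_comp {E}.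
move: (rten (B ⊗ A) f) (rten (A ⊗ B) f) (rten A (rten B f)) N S => p q r N S.
rewrite !comp_assoc.
rewrite (reassoc2 (eq_sym (fmap_comp _ _ _))) (reassoc2 (eq_sym (fmap_comp _ _ _))).
rewrite (comp_assoc (assoc A Y B)) hexagon !fmap_comp !comp_assoc.
rewrite (reassoc2 N) comp_assoc (reassoc2 S) !comp_assoc.
congr (_ ∘ (_ ∘ _)).
have H : assoc A B X ∘ (braid B A ⊠ id_ X) ∘ assoc_inv B A X
    = (id_ A ⊠ braid X B) ∘ assoc A X B ∘ braid B (A ⊗ X).
  rewrite -[X in X ∘ _ = _]comp_id_l -tmap_id -[X in X ⊠ _](comp_id_l (id_ A)).
  rewrite -(braid_sym B X) tmap_comp !comp_assoc.
  by rewrite (reassoc3 (eq_sym (hexagon _ _ _))) !comp_assoc assoc_invK comp_id_r.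
by rewrite (reassoc3 H) !comp_assoc braid_sym comp_id_r.
Qed.

Lemma is_central_coneP (X Y : C) (f : Hom X (T Y)) :
  is_central_cone f <-> is_central f.
Proof.
have El (Y' : C) : lten f Y' ⊙ str T X Y'
    = mu T (Y ⊗ Y') ∘ fmap T (rstr T Y Y') ∘ str T (T Y) Y' ∘ (f ⊠ id_ (T Y')).
  by rewrite str_nat_l /kcomp /lten fmap_comp !comp_assoc.
have Er (Y' : C) : str T Y Y' ⊙ lten f (T Y')
    = mu T (Y ⊗ Y') ∘ fmap T (str T Y Y') ∘ rstr T Y (T Y') ∘ (f ⊠ id_ (T Y')).
  by [].
split=> [H X' Y' f' | H Y'].
- rewrite /rten -kcomp_pre El H -Er kcomp_mid kcomp_pre; congr (_ ⊙ _).
  by rewrite lten_nat.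
- by move: (H _ _ (id_ (T Y'))); rewrite /rten !tmap_id !comp_id_r El Er.
Qed.

Lemma is_central_pure (X Y : C) (h : Hom X Y) : is_central (eta T Y ∘ h).
Proof.
by move=> X' Y' f'; rewrite !lten_pure kcomp_pure_l kcomp_pure_r rten_nat.
Qed.

Lemma is_central_eta (X : C) : is_central (eta T X).
Proof. by rewrite -(comp_id_r (eta T X)); exact: is_central_pure. Qed.

Lemma is_central_kcomp (X Y Z : C) (g : Hom Y (T Z)) (f : Hom X (T Y)) :
  is_central g -> is_central f -> is_central (g ⊙ f).
Proof.
move=> Hg Hf X' Y' f'.
by rewrite !lten_kcomp kcomp_assoc Hf -kcomp_assoc Hg kcomp_assoc.
Qed.

Lemma is_central_rten (A X Y : C) (f : Hom X (T Y)) :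
  is_central f -> is_central (rten A f).
Proof.
move=> Hf X' Y' f'.
suff E : fmap T (assoc A Y Y') ∘ (lten (rten A f) Y' ⊙ rten (A ⊗ X) f')
       = fmap T (assoc A Y Y') ∘ (rten (A ⊗ Y) f' ⊙ lten (rten A f) X').
  rewrite -[LHS]comp_id_l -[RHS]comp_id_l -fmap_id -assocK fmap_comp.
  by rewrite !(comp_assoc (fmap T (assoc_inv _ _ _))) E.
rewrite !kcomp_post lten_assoc rten_assoc !(kcomp_mid _ (assoc _ _ _)) rten_assoc lten_assoc.
by rewrite -!(kcomp_pre _ _ (assoc _ _ _)) -!rten_kcomp Hf.
Qed.

Lemma central_hom_eq (X Y : C) (f g : {f : Hom X (T Y) | is_central f}) :
  proj1_sig f = proj1_sig g -> f = g.
Proof.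
case: f g => [f Hf] [g Hg] /= E; case: g / E Hg => Hg.
by congr (exist _ _ _); exact: proof_irrelevance.
Qed.

Definition central_subcategory : Category.
Proof.
refine {| ob := ob C;
          Hom := fun X Y => {f : Hom X (T Y) | is_central f};
          id_ := fun X => exist _ (eta T X) (@is_central_eta X);
          comp := fun X Y Z g f => exist _ (proj1_sig g ⊙ proj1_sig f)
            (is_central_kcomp (proj2_sig g) (proj2_sig f)) |}.
- abstract by move=> X Y f; apply: central_hom_eq; exact: kcomp_id_l.
- abstract by move=> X Y f; apply: central_hom_eq; exact: kcomp_id_r.
- abstract by move=> X Y Z W h g f; apply: central_hom_eq; exact: kcomp_assoc.
Defined.

Definition central_inclusion : Functor central_subcategory (kleisli T) :=
  {| fobj := fun X : central_subcategory => X : kleisli T;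
     fmap := fun (X Y : central_subcategory) (f : Hom X Y) => proj1_sig f;
     fmap_id := fun X => eq_refl;
     fmap_comp := fun X Y Z g f => eq_refl |}.

End Central.
Arguments central_subcategory {C} T.
Arguments central_inclusion {C} T.
Arguments Centralisable {C} T.

Definition kleisli_embedding (C : SymMonCat) (S T : StrongMonad C)
    (i : forall X : C, Hom (S X) (T X)) (Hi : is_strong_monad_morphism i) :
    Functor (kleisli S) (kleisli T).
Proof.
refine {| fobj := fun X : kleisli S => X : kleisli T;
          fmap := fun (X Y : kleisli S) f => (i Y ∘ f : @Hom C X (T Y)) |}.
- abstract by move=> X; exact: smm_eta Hi X.
- abstract (move=> X Y Z g f; rewrite /= /kcomp (reassoc2 (smm_mu Hi _));
    by rewrite fmap_comp !comp_assoc (reassoc2 (smm_nat Hi _)) comp_assoc).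
Defined.

Section Centre.
Context (C : SymMonCat) (T : StrongMonad C) (c : Centralisable T).

Definition centre_ob (X : C) : C := apex (c X).

Definition iota (X : C) : Hom (centre_ob X) (T X) := leg (c X).

Definition factor (X W : C) (f : Hom W (T X)) (Hf : is_central f) :
    Hom W (centre_ob X) :=
  tcc_lift (c X)
    {| leg := f; leg_central := proj2 (is_central_coneP f) Hf |}.

Lemma iota_factor (X W : C) (f : Hom W (T X)) (Hf : is_central f) :
  iota X ∘ factor Hf = f.
Proof. exact (tcc_lift_comm (c X) {| leg := f |}). Qed.

Lemma iota_central (X : C) : is_central (iota X).
Proof. by apply/is_central_coneP; exact: leg_central. Qed.

Lemma iota_mono (X : C) : is_mono (iota X).
Proof.
move=> W f g E.
have Hg : is_central (iota X ∘ g).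
  rewrite -kcomp_pure_r; apply: is_central_kcomp; first exact: iota_central.
  exact: is_central_pure.
pose k := {| leg := iota X ∘ g; leg_central := proj2 (is_central_coneP _) Hg |}.
by rewrite (@tcc_lift_unique _ _ _ (c X) k f E)
  (@tcc_lift_unique _ _ _ (c X) k g (eq_refl _)).
Qed.

Lemma centre_map_central (X Y : C) (f : Hom X Y) :
  is_central (fmap T f ∘ iota X).
Proof.
rewrite -kcomp_pure_l; apply: is_central_kcomp; first exact: is_central_pure.
exact: iota_central.
Qed.

Lemma centre_mu_central (X : C) :
  is_central (mu T X ∘ fmap T (iota X) ∘ iota (centre_ob X)).
Proof. apply: is_central_kcomp; exact: iota_central. Qed.

Lemma centre_str_central (X Y : C) :
  is_central (str T X Y ∘ (id_ X ⊠ iota Y)).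
Proof. apply: is_central_rten; exact: iota_central. Qed.

Definition centre_map (X Y : C) (f : Hom X Y) :
    Hom (centre_ob X) (centre_ob Y) := factor (centre_map_central f).

Definition centre_eta (X : C) : Hom X (centre_ob X) :=
  factor (@is_central_eta C T X).

Definition centre_mu (X : C) : Hom (centre_ob (centre_ob X)) (centre_ob X) :=
  factor (@centre_mu_central X).

Definition centre_str (X Y : C) :
    Hom (X ⊗ centre_ob Y) (centre_ob (X ⊗ Y)) :=
  factor (@centre_str_central X Y).

Lemma iota_map (X Y : C) (f : Hom X Y) :
  iota Y ∘ centre_map f = fmap T f ∘ iota X.
Proof. exact: iota_factor. Qed.

Lemma iota_eta (X : C) : iota X ∘ centre_eta X = eta T X.
Proof. exact: iota_factor. Qed.

Lemma iota_mu (X : C) :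
  iota X ∘ centre_mu X = iota X ⊙ iota (centre_ob X).
Proof. exact: iota_factor. Qed.

Lemma iota_str (X Y : C) :
  iota (X ⊗ Y) ∘ centre_str X Y = rten X (iota Y).
Proof. exact: iota_factor. Qed.

Lemma iota_bind (X Y Z : C) (g : Hom Y (centre_ob Z)) (f : Hom X (centre_ob Y)) :
  iota Z ∘ centre_mu Z ∘ centre_map g ∘ f = (iota Z ∘ g) ⊙ (iota Y ∘ f).
Proof.
rewrite -comp_assoc iota_mu kcomp_pre (reassoc2 (iota_map _)).
by rewrite kcomp_mid comp_assoc.
Qed.

Definition centre_functor : Functor C C.
Proof.
refine {| fobj := centre_ob; fmap := centre_map |}.
- abstract by move=> X; apply: iota_mono;
    rewrite iota_map fmap_id comp_id_l comp_id_r.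
- abstract by move=> X Y Z g f; apply: iota_mono;
    rewrite iota_map (reassoc2 (iota_map _)) fmap_comp !comp_assoc iota_map.
Defined.

Definition centre_monad : Monad C.
Proof.
refine {| mon_functor := centre_functor; eta := centre_eta; mu := centre_mu |}.
- abstract by move=> X Y f; apply: iota_mono;
    rewrite /= (reassoc2 (iota_eta _)) (reassoc2 (iota_map _)) comp_assoc
      iota_eta eta_nat.
- abstract by move=> X Y f; apply: iota_mono;
    rewrite /= -comp_assoc iota_mu kcomp_pre iota_map -kcomp_mid iota_map
      (reassoc2 (iota_map _)) comp_assoc iota_mu kcomp_post.
- abstract by move=> X; apply: iota_mono;
    rewrite /= (reassoc2 (iota_mu _)) kcomp_pre iota_eta kcomp_id_r comp_id_r.
- abstract by move=> X; apply: iota_mono;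
    rewrite /= (reassoc2 (iota_mu _)) kcomp_pre iota_map -kcomp_mid iota_eta
      kcomp_id_l comp_id_r.
- abstract by move=> X; apply: iota_mono;
    rewrite /= !(reassoc2 (iota_mu _)) !kcomp_pre iota_map -kcomp_mid !iota_mu
      kcomp_assoc.
Defined.

Definition centre : StrongMonad C.
Proof.
refine {| sm_monad := centre_monad; str := centre_str |}.
- abstract by move=> X X' Y Y' f g; apply: iota_mono;
    rewrite /= (reassoc2 (iota_str _ _)) (reassoc2 (iota_map _)) comp_assoc
      iota_str /rten comp_assoc -tmap_compr iota_map (reassoc2 (eq_sym (str_nat _ _ _)))
      comp_assoc -tmap_comp comp_id_r.
- abstract by move=> X; apply: iota_mono;
    rewrite /= (reassoc2 (iota_map _)) comp_assoc iota_str /rten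
      (reassoc2 (str_lunit _ _)) lunit_nat.
- abstract by move=> X Y Z; apply: iota_mono;
    rewrite /= (reassoc2 (iota_map _)) comp_assoc iota_str rten_assoc
      (reassoc2 (iota_str _ _)) -(comp_assoc (rten _ _)) -rten_comp iota_str.
- abstract by move=> X Y; apply: iota_mono;
    rewrite /= (reassoc2 (iota_str _ _)) -rten_comp !iota_eta /rten str_eta.
- abstract by move=> X Y; apply: iota_mono;
    rewrite /= iota_bind (reassoc2 (iota_str _ _)) -rten_comp iota_mu
      rten_kcomp !iota_str.
Defined.

Lemma iota_strong_monad_morphism : @is_strong_monad_morphism C centre T iota.
Proof.
split; [exact: iota_map | exact: iota_eta | exact: iota_mu | exact: iota_str].
Qed.

Lemma iota_rstr (X Y : C) :
  iota (X ⊗ Y) ∘ rstr centre X Y = lten (iota X) Y.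
Proof.
by rewrite /rstr /= (reassoc2 (iota_map _)) comp_assoc (reassoc2 (iota_str _ _))
  lten_rten.
Qed.

Lemma centre_commutative : is_commutative centre.
Proof.
move=> X Y; apply: iota_mono.
by rewrite /= !iota_bind !iota_rstr !iota_str; exact: iota_central.
Qed.

Definition canonical_embedding : Functor (kleisli centre) (kleisli T) :=
  kleisli_embedding iota_strong_monad_morphism.

End Centre.

(* Main.v *)
From Stdlib Require Import ssreflect ProofIrrelevance FunctionalExtensionality.
Require Import Defs.

Set Implicit Arguments.
Unset Strict Implicit.
Unset Printing Implicit Defensive.

(** Precomposing the central morphism [iota Y] with a pure map keeps it central,
    and conversely every central [X -> T Y] is the leg of a central cone, so it
    factors through [iota Y], uniquely since [iota Y] is monic.  Composition with
    [iota Y] is therefore a bijection from [Hom X (centre c Y)] to the central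
    morphisms; the inverse is functorial because [iota] is monic. *)

(** Sharing the object map [o] avoids transport between hom-types; the functor laws then agree by
    proof irrelevance. *)
Lemma functor_ext (C D : Category) (o : C -> D)
    (m m' : forall X Y : C, Hom X Y -> Hom (o X) (o Y)) i i' k k' :
  (forall X Y (f : Hom X Y), m X Y f = m' X Y f) ->
  @Build_Functor C D o m i k = @Build_Functor C D o m' i' k'.
Proof.
move=> E.
have {}E : m = m'.
  by do 3 (apply: functional_extensionality_dep => ?); exact: E.
by case: m' / E i' k' => i' k'; congr Build_Functor; exact: proof_irrelevance.
Qed.

Lemma iota_comp_central (C : SymMonCat) (T : StrongMonad C)
    (c : Centralisable T) (X Y : C) (f : Hom X (centre_ob c Y)) :
  is_central (iota c Y ∘ f).
Proof.
(* Precomposition with [f] is Kleisli composition with [eta T _ ∘ f]. *)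
rewrite -kcomp_pure_r; apply: is_central_kcomp; first exact: iota_central.
exact: is_central_pure.
Qed.

Definition central_corestriction (C : SymMonCat) (T : StrongMonad C)
    (c : Centralisable T) :
  Functor (kleisli (centre c)) (central_subcategory T).
Proof.
refine (@Build_Functor (kleisli (centre c)) (central_subcategory T) (fun X => X)
  (fun X Y f => exist _ (iota c Y ∘ f) (iota_comp_central f)) _ _).
- abstract by move=> X; apply: central_hom_eq; exact: iota_eta.
- abstract by move=> X Y Z g f; apply: central_hom_eq; exact: iota_bind.
Defined.

Definition central_factorisation (C : SymMonCat) (T : StrongMonad C)
    (c : Centralisable T) :
  Functor (central_subcategory T) (kleisli (centre c)).
Proof.
refine (@Build_Functor (central_subcategory T) (kleisli (centre c)) (fun X => X)
  (fun X Y f => factor c (proj2_sig f)) _ _).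
- abstract by move=> X; apply: (@iota_mono _ _ c); rewrite iota_factor.
(* Under [iota], Kleisli composition for the centre becomes [⊙] for [T]. *)
- abstract by move=> X Y Z g f; apply: (@iota_mono _ _ c);
    rewrite iota_factor /= /kcomp /= iota_bind !iota_factor.
Defined.

Theorem theorem2p10 (C : SymMonCat) (T : StrongMonad C) (c : Centralisable T) :
  exists J : Functor (kleisli (centre c)) (central_subcategory T),
    functor_comp (central_inclusion T) J = canonical_embedding c
    /\ is_iso_of_categories J.
Proof.
(* Both functors send [f] to [iota c Y ∘ f] by computation; only the proofs of the laws differ. *)
exists (central_corestriction c); split; first exact: functor_ext.
exists (central_factorisation c); split; apply: functor_ext => X Y f /=.
- by apply: (@iota_mono _ _ c); rewrite iota_factor.
- by apply: central_hom_eq; exact: iota_factor.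
Qed.
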